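(* The sequence $\left\{\frac{1}{\sqrt[n]{T_n}}\right\}_{n\geq 1}$ is almost infinitely log-monotonic, where $T_n$ is the $n$th tangent number.
   Context: The tangent numbers $T_n=T(n)$, $n\ge 1$, are defined by $\tan x=\sum_{n\geq 1}T(n)\frac{x^{2n-1}}{(2n-1)!}$ (so $T(1)=1$, $T(2)=2$, $T(3)=16$, $T(4)=272$, $T(5)=7936$). A sequence $\{a_n\}$ of positive real numbers is log-concave if $a_{n+1}^2\ge a_na_{n+2}$ for all $n$, and log-convex if $a_{n+1}^2\le a_na_{n+2}$ for all $n$. Define an operator $R$ on sequences of positive reals by $R\{z_n\}=\{x_n\}$ with $x_n=z_{n+1}/z_n$, and let $R^r$ be its $r$-fold iterate ($R^0$ is the identity). A sequence $\{z_n\}$ is infinitely log-monotonic if $R^r\{z_n\}$ is log-concave for all odd $r$ and log-convex for all even $r\ge 0$. It is almost infinitely log-monotonic if this holds at each order except for certain terms at the beginning, i.e. for every integer $r\ge 0$ there is $N_r$ such that the sequence $R^r\{z_n\}$ restricted to indices $n\ge N_r$ is log-convex if $r$ is even and log-concave if $r$ is odd. *)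

(* Defs.v *)
From Stdlib Require Export Reals Arith.
From Coquelicot Require Export Coquelicot.
Open Scope R_scope.

(* Sequences indexed by n >= 1 are functions on nat whose value at 0 is
   irrelevant.  In the series n = S k; the expansion is required on some
   neighbourhood of 0, which already determines T n for every n >= 1. *)
Definition is_tangent_numbers (T : nat -> R) : Prop :=
  locally 0 (fun x : R =>
    is_series (fun k : nat =>
                 let n := S k in
                 T n * (x ^ (2 * n - 1) / INR (fact (2 * n - 1))))
              (tan x)).

Definition log_concave_from (N : nat) (a : nat -> R) : Prop :=
  forall n : nat, (N <= n)%nat -> a (n + 1)%nat ^ 2 >= a n * a (n + 2)%nat.

Definition log_convex_from (N : nat) (a : nat -> R) : Prop :=
  forall n : nat, (N <= n)%nat -> a (n + 1)%nat ^ 2 <= a n * a (n + 2)%nat.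

Definition ratio_seq (z : nat -> R) : nat -> R :=
  fun n => z (n + 1)%nat / z n.

Definition almost_infinitely_log_monotonic (z : nat -> R) : Prop :=
  (forall n : nat, (1 <= n)%nat -> 0 < z n) /\
  forall r : nat, exists N : nat, (1 <= N)%nat /\
    (Nat.Even r -> log_convex_from N (Nat.iter r ratio_seq z)) /\
    (Nat.Odd r -> log_concave_from N (Nat.iter r ratio_seq z)).

(* Rpower x (/ INR n) is the n-th root of x only for x > 0 and n >= 1; the
   tangent numbers are positive. *)
Definition nth_root (n : nat) (x : R) : R := Rpower x (/ INR n).

(* Main.v *)
Require Import Defs.
From Stdlib Require Import Reals Lra Lia.
From Coquelicot Require Import Coquelicot.
Open Scope R_scope.

(** Put F n = (ln T_n) / n, so that the sequence in question is exp (- F n) and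
    its m-th ratio sequence is exp (- Delta^m F), where Delta is the forward
    difference.  Log-convexity or log-concavity of order m is then the sign of
    Delta^(m+2) F, and it suffices that F is asymptotic to a positive multiple
    of ln n at the level of all differences: n^(k+1) Delta^(k+1) F n tends to
    c (-1)^k k! with c > 0 ([log_like], [log_like_sign]).

    The sequence n F n = ln T_n is easier to difference than F, and the product
    rule n Delta^(k+1) F n + (k+1) Delta^k F (n+1) = Delta^(k+1) (n F) n passes
    from one to the other: if Delta (n F) is logarithm-like with constant c, so is F
    ([log_like_of_fdiff_INR_mult]).  The first difference of F is out of reach of
    this rule, which would need F itself; there Cesaro means replace Stirling's
    formula.

    It remains to know T_n well.  With y = (pi/2)^2 one has
    T_(n+1) = (2n+1)! y^(-n) (l + O(q^n)) for some l > 0 and q < 1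
    ([tan_coef_asymptotics]), hence Delta ln T_(n+1) is
    ln (n+1) + ln (n+3/2), plus a constant, plus a geometrically small error,
    and c = 2 ([log_like_ln_tangent_div]).  The differences of the
    logarithms come from the mean value theorem; the error is negligible because
    no power of n compensates a geometric decay.

    The estimate of T_n says that the singularity of tan nearest to 0 is a simple
    pole at pi/2.  Real power series are enough to show it: write
    u = (2x/pi)^2, so that cos x = (1 - u) r(u), where the coefficients of r
    are the partial sums of those of cos and, as cos vanishes at pi/2,
    also minus their tails.  Already pi <= 4 makes these tails so small
    that the coefficients of r after the first have absolute sum below 1, with
    room to spare.  Thus r has an inverse whose radius of convergence exceeds 1,
    and tan x / x times (1 - u), which is (sin x / x) / r, has geometrically
    decaying coefficients ([decay_of_convolution]).  Summing them gives
    the limit l, which is positive because l r(1) = 2/pi and r(1) > 0. *)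

(** * The power series of tan, sin and cos in the square of the variable *)

Lemma CV_radius_ge_of_ex_pseries (a : nat -> R) (x : R) :
  0 <= x -> ex_pseries a x -> Rbar_le x (CV_radius a).
Proof.
  intros Hx Ha.
  apply Rbar_not_lt_le; intros Hlt.
  apply (CV_disk_outside a x).
  - now rewrite Rabs_pos_eq.
  - apply ex_series_lim_0, ex_pseries_R, Ha.
Qed.

(** Identity theorem from one side of 0: substituting u = x^2 for real x
    reaches positive u only.  Continuity at 0 identifies the constant
    terms, and the rest follows by dividing by u and repeating. *)
Lemma PSeries_eq_right_coef (a b : nat -> R) (d : R) :
  0 < d -> Rbar_lt 0 (CV_radius a) -> Rbar_lt 0 (CV_radius b) ->
  (forall u, 0 < u < d -> ex_pseries a u /\ ex_pseries b u /\
                          PSeries a u = PSeries b u) ->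
  forall n, a n = b n.
Proof.
  intros Hd Ha Hb Heq n; revert a b Ha Hb Heq.
  assert (Hu : is_lim_seq (fun k => d * / INR (S (S k))) 0).
  { replace (Finite 0) with (Rbar_mult d 0) by (simpl; f_equal; ring).
    apply is_lim_seq_scal_l.
    apply (is_lim_seq_incr_1 (fun k => / INR (S k))).
    apply (is_lim_seq_incr_1 (fun k => / INR k)).
    exact (is_lim_seq_inv _ _ is_lim_seq_INR ltac:(discriminate)). }
  assert (Hr : forall k, 0 < d * / INR (S (S k)) < d).
  { intros k. assert (H : 1 < INR (S (S k))) by (rewrite S_INR; generalize (pos_INR k); rewrite S_INR; lra).
    split.
    - apply Rmult_lt_0_compat; [lra | apply Rinv_0_lt_compat; lra].
    - rewrite <- (Rmult_1_r d) at 2. apply Rmult_lt_compat_l; [lra|].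
      rewrite <- Rinv_1. apply Rinv_lt_contravar; lra. }
  assert (H0 : forall a b, Rbar_lt 0 (CV_radius a) -> Rbar_lt 0 (CV_radius b) ->
    (forall u, 0 < u < d -> ex_pseries a u /\ ex_pseries b u /\
                          PSeries a u = PSeries b u) -> a 0%nat = b 0%nat).
  { intros a b Ha Hb Heq.
    rewrite <- (PSeries_0 a), <- (PSeries_0 b).
    assert (La := is_lim_seq_continuous (PSeries a) _ 0
      (PSeries_continuity a 0 ltac:(now rewrite Rabs_R0)) Hu).
    assert (Lb := is_lim_seq_continuous (PSeries b) _ 0
      (PSeries_continuity b 0 ltac:(now rewrite Rabs_R0)) Hu).
    apply (is_lim_seq_ext _ (fun k => PSeries b (d * / INR (S (S k))))) in La.
    2: { intros k. apply (Heq _ (Hr k)). }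
    apply is_lim_seq_unique in La. apply is_lim_seq_unique in Lb.
    rewrite La in Lb. now injection Lb. }
  induction n as [|n IH]; intros a b Ha Hb Heq.
  - now apply H0.
  - apply (IH (PS_decr_1 a) (PS_decr_1 b)).
    + now rewrite CV_radius_decr_1.
    + now rewrite CV_radius_decr_1.
    + intros u Hu'. destruct (Heq u Hu') as (Ea & Eb & E).
      split; [|split].
      * apply ex_pseries_decr_1; [right; exists (/ u); apply Rinv_l; lra | exact Ea].
      * apply ex_pseries_decr_1; [right; exists (/ u); apply Rinv_l; lra | exact Eb].
      * rewrite (PSeries_decr_1 a), (PSeries_decr_1 b), (H0 a b Ha Hb Heq) in E by assumption.
        apply (Rmult_eq_reg_l u); lra.
Qed.

Lemma is_pseries_cos_n (x : R) : is_pseries cos_n (Rsqr x) (cos x).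
Proof.
  apply is_pseries_R, is_series_Reals.
  unfold cos. destruct (exist_cos (Rsqr x)) as [l Hl]. exact Hl.
Qed.

Lemma is_pseries_sin_n (x : R) : x <> 0 -> is_pseries sin_n (Rsqr x) (sin x / x).
Proof.
  intros Hx. apply is_pseries_R, is_series_Reals.
  unfold sin. destruct (exist_sin (Rsqr x)) as [l Hl].
  replace (x * l / x) with l by (field; exact Hx). exact Hl.
Qed.

(** The coefficient of u^k in the expansion of tan x / x, where u = x^2. *)
Definition tan_coef (T : nat -> R) (k : nat) : R :=
  T (S k) / INR (fact (2 * S k - 1)).

(** This is cos x * (tan x / x) = sin x / x, read coefficient by coefficient. *)
Lemma tan_coef_convolution (T : nat -> R) :
  is_tangent_numbers T ->
  forall n, PS_mult cos_n (tan_coef T) n = sin_n n.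
Proof.
  intros [d hd].
  assert (Ht : forall x, 0 < x < d -> is_pseries (tan_coef T) (Rsqr x) (tan x / x)).
  { intros x Hx. apply is_pseries_R.
    assert (H : is_series (fun k => / x * (T (S k) * (x ^ (2 * S k - 1) / INR (fact (2 * S k - 1)))))
                  (/ x * tan x)).
    { refine (is_series_scal_l (/ x) _ (tan x) (hd x _)).
      change (Rabs (x - 0) < d). rewrite Rminus_0_r, Rabs_pos_eq; lra. }
    replace (tan x / x) with (/ x * tan x) by (unfold Rdiv; ring).
    revert H; apply is_series_ext; intros k.
    unfold tan_coef.
    replace (Rsqr x ^ k) with (x ^ (2 * k)) by (rewrite pow_mult; f_equal; unfold Rsqr; ring).
    replace (x ^ (2 * S k - 1)) with (x * x ^ (2 * k))
      by (replace (2 * S k - 1)%nat with (S (2 * k)) by lia; reflexivity).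
    match goal with |- ?a = ?b => change (@eq R a b) end.
    field. split; [apply INR_fact_neq_0 | lra]. }
  (* Below 1 the cosine does not vanish, and below d the expansion of tan holds. *)
  set (e := Rmin d 1).
  assert (He : 0 < e) by (apply Rmin_pos; [apply cond_pos | lra]).
  assert (Hrad : forall a v, is_pseries a (Rsqr (e / 2)) v -> Rbar_le (Rsqr (e / 2)) (CV_radius a)).
  { intros a v Hv. apply CV_radius_ge_of_ex_pseries; [apply Rle_0_sqr | now exists v]. }
  assert (He2 : 0 < e / 2 < d) by (generalize (Rmin_l d 1); fold e; lra).
  assert (Rt := Hrad _ _ (Ht _ He2)).
  assert (Rc := Hrad _ _ (is_pseries_cos_n (e / 2))).
  assert (Rs := Hrad _ _ (is_pseries_sin_n (e / 2) ltac:(lra))).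
  assert (Hpos : 0 < Rsqr (e / 2)) by (apply Rlt_0_sqr; lra).
  assert (Hin : forall u, 0 < u < Rsqr (e / 2) ->
    is_pseries (PS_mult cos_n (tan_coef T)) u (sin (sqrt u) / sqrt u) /\
    is_pseries sin_n u (sin (sqrt u) / sqrt u)).
  { intros u [Hu0 Hu].
    assert (Hs : 0 < sqrt u) by now apply sqrt_lt_R0.
    assert (Hse : sqrt u < e / 2).
    { rewrite <- (sqrt_Rsqr (e / 2)) by lra. apply sqrt_lt_1; lra. }
    assert (Hc : 0 < cos (sqrt u)).
    { apply cos_gt_0; generalize PI2_3_2, (Rmin_r d 1); fold e; lra. }
    assert (Hsq : Rsqr (sqrt u) = u) by (apply Rsqr_sqrt; lra).
    assert (Habs : Rabs u = u) by (apply Rabs_pos_eq; lra).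
    split.
    - replace (sin (sqrt u) / sqrt u) with (cos (sqrt u) * (tan (sqrt u) / sqrt u))
        by (unfold tan; field; lra).
      apply is_pseries_mult.
      + rewrite <- Hsq at 1. apply is_pseries_cos_n.
      + rewrite <- Hsq at 1. apply Ht. lra.
      + rewrite Habs. eapply Rbar_lt_le_trans; [|exact Rc]. exact Hu.
      + rewrite Habs. eapply Rbar_lt_le_trans; [|exact Rt]. exact Hu.
    - rewrite <- Hsq at 1. apply is_pseries_sin_n. lra. }
  apply (PSeries_eq_right_coef _ _ (Rsqr (e / 2)) Hpos).
  - destruct (Hin (Rsqr (e / 2) / 2)) as [H _]; [lra|].
    eapply Rbar_lt_le_trans; [|apply (CV_radius_ge_of_ex_pseries _ (Rsqr (e / 2) / 2)); [lra | now eexists; exact H]].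
    simpl; lra.
  - eapply Rbar_lt_le_trans; [|exact Rs]. exact Hpos.
  - intros u Hu. destruct (Hin u Hu) as [H1 H2].
    split; [now eexists; exact H1|]. split; [now eexists; exact H2|].
    now rewrite (is_pseries_unique _ _ _ H1), (is_pseries_unique _ _ _ H2).
Qed.

(** * Dividing out the pole at pi/2 *)

(** If r 0 = 1 and the other coefficients of r satisfy
    sum_(k >= 1) |r k| q^(-k) <= K / (q - th) < 1, then r has an inverse
    whose coefficients are O(q^n), so that b / r decays like b.  With
    |D (n - k)| <= M q^(n-k) the recursion for D n gives the bound
    (1 + M K / (q - th)) q^n, and M = 20 reproduces itself as
    1 + 20 * 19 / 20 = 20. *)
Lemma decay_of_convolution (r D b : nat -> R) (K th q : R) :
  0 <= K -> 0 <= th < q -> K / (q - th) <= 19 / 20 ->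
  r 0%nat = 1 ->
  (forall k, Rabs (r (S k)) <= K * th ^ k) ->
  (forall n, Rabs (b n) <= q ^ n) ->
  (forall n, PS_mult r D n = b n) ->
  forall n, Rabs (D n) <= 20 * q ^ n.
Proof.
  intros HK Hq Hc H0 Hr Hb Hconv n.
  induction n as [n IH] using lt_wf_ind.
  assert (Hqn := pow_le q n ltac:(lra)).
  destruct n as [|n].
  - specialize (Hconv 0%nat). unfold PS_mult in Hconv. simpl in Hconv.
    rewrite H0, Rmult_1_l in Hconv. rewrite Hconv.
    generalize (Hb 0%nat). simpl. lra.
  - specialize (Hconv (S n)). unfold PS_mult in Hconv.
    rewrite decomp_sum in Hconv by lia. rewrite H0 in Hconv. simpl pred in Hconv.
    replace (S n - 0)%nat with (S n) in Hconv by lia.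
    set (s := sum_f_R0 (fun i => r (S i) * D (S n - S i)%nat) n) in Hconv.
    assert (Hs : Rabs s <= 20 * K * sum_f_R0 (fun i => th ^ i * q ^ (n - i)) n).
    { eapply Rle_trans; [apply Rsum_abs|].
      rewrite scal_sum. apply sum_Rle. intros i Hi.
      rewrite Rabs_mult.
      replace (th ^ i * q ^ (n - i) * (20 * K)) with (K * th ^ i * (20 * q ^ (n - i))) by ring.
      apply Rmult_le_compat; try apply Rabs_pos; [apply Hr|].
      change (S n - S i)%nat with (n - i)%nat. apply IH. lia. }
    (* The telescoping of q^(n+1) - th^(n+1). *)
    assert (Hg : (q - th) * sum_f_R0 (fun i => th ^ i * q ^ (n - i)) n = q ^ S n - th ^ S n).
    { clear. induction n as [|n IH]; [simpl; ring|].
      rewrite tech5.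
      rewrite (sum_eq _ (fun i => th ^ i * q ^ (n - i) * q)).
      - rewrite <- scal_sum, Nat.sub_diag.
        transitivity (q * ((q - th) * sum_f_R0 (fun i : nat => th ^ i * q ^ (n - i)) n) + (q - th) * th ^ S n);
          [simpl; ring|]. rewrite IH. simpl; ring.
      - intros i Hi. replace (S n - i)%nat with (S (n - i)) by lia. simpl; ring. }
    assert (Hs2 : Rabs s <= 19 * q ^ S n).
    { eapply Rle_trans; [exact Hs|].
      replace (sum_f_R0 _ n) with ((q ^ S n - th ^ S n) / (q - th))
        by (rewrite <- Hg; field; lra).
      replace (20 * K * ((q ^ S n - th ^ S n) / (q - th)))
        with (K / (q - th) * (20 * (q ^ S n - th ^ S n))) by (field; lra).
      assert (Hth := pow_le th (S n) ltac:(lra)).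
      assert (H1 : 0 <= K / (q - th)).
      { apply Rmult_le_pos; [lra|]. apply Rlt_le, Rinv_0_lt_compat; lra. }
      nra. }
    replace (D (S n)) with (b (S n) - s) by lra.
    eapply Rle_trans; [apply Rabs_triang|]. rewrite Rabs_Ropp.
    generalize (Hb (S n)). lra.
Qed.

(** The coefficients of (1 - X) times the power series with coefficients a. *)
Definition backward (a : nat -> R) (n : nat) : R :=
  match n with O => a O | S m => a (S m) - a m end.

Lemma sum_backward (a : nat -> R) (n : nat) : sum_f_R0 (backward a) n = a n.
Proof.
  induction n as [|n IH]; [reflexivity|].
  rewrite tech5, IH. simpl. ring.
Qed.

(** Partial summation divides c by 1 - X, and [backward] multiplies a by it. *)
Lemma PS_mult_sum_backward (c a : nat -> R) (n : nat) :
  PS_mult (sum_f_R0 c) (backward a) n = PS_mult c a n.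
Proof.
  unfold PS_mult. destruct n as [|n]; [reflexivity|].
  rewrite tech5, Nat.sub_diag.
  rewrite (sum_eq _ (fun k => sum_f_R0 c k * a (S n - k)%nat - sum_f_R0 c k * a (n - k)%nat)).
  2: { intros i Hi. replace (S n - i)%nat with (S (n - i)) by lia. simpl. ring. }
  rewrite minus_sum.
  assert (E := tech5 (fun k => sum_f_R0 c k * a (S n - k)%nat) n).
  rewrite decomp_sum in E by lia. simpl pred in E. rewrite Nat.sub_diag in E.
  rewrite (sum_eq (fun i => sum_f_R0 c (S i) * a (S n - S i)%nat)
      (fun i => c (S i) * a (n - i)%nat + sum_f_R0 c i * a (n - i)%nat)) in E.
  2: { intros i Hi. simpl. ring. }
  rewrite sum_plus in E.
  rewrite (decomp_sum (fun k => c k * a (S n - k)%nat)) by lia. simpl pred.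
  change (fun i => c (S i) * a (S n - S i)%nat) with (fun i => c (S i) * a (n - i)%nat).
  change (sum_f_R0 c 0%nat) with (c 0%nat) in E. change (backward a 0%nat) with (a 0%nat).
  lra.
Qed.

Lemma Rsqr_PI2_bounds : 0 < Rsqr (PI / 2) <= 4.
Proof. unfold Rsqr. generalize PI_4 PI2_3_2. nra. Qed.

Lemma Rabs_cos_n_succ (n : nat) :
  Rabs (cos_n (S n)) = Rabs (cos_n n) / ((2 * INR n + 1) * (2 * INR n + 2)).
Proof.
  assert (H := simpl_cos_n n).
  assert (Hn := pos_INR n).
  replace (cos_n (S n)) with (cos_n n * - / ((2 * INR n + 1) * (2 * INR n + 2))).
  - rewrite Rabs_mult, Rabs_Ropp, (Rabs_pos_eq (/ _)); [reflexivity|].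
    apply Rlt_le, Rinv_0_lt_compat. nra.
  - replace (- / ((2 * INR n + 1) * (2 * INR n + 2))) with (cos_n (S n) / cos_n n).
    + field. apply cosn_no_R0.
    + rewrite H. f_equal. f_equal.
      rewrite ?mult_INR, ?plus_INR, ?mult_INR, !S_INR. change (INR 0) with 0. ring.
Qed.

Lemma Rabs_sin_n_succ (n : nat) :
  Rabs (sin_n (S n)) = Rabs (sin_n n) / ((2 * INR n + 2) * (2 * INR n + 3)).
Proof.
  assert (H := simpl_sin_n n).
  assert (Hn := pos_INR n).
  replace (sin_n (S n)) with (sin_n n * - / ((2 * INR n + 2) * (2 * INR n + 3))).
  - rewrite Rabs_mult, Rabs_Ropp, (Rabs_pos_eq (/ _)); [reflexivity|].
    apply Rlt_le, Rinv_0_lt_compat. nra.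
  - replace (- / ((2 * INR n + 2) * (2 * INR n + 3))) with (sin_n (S n) / sin_n n).
    + field. apply sin_no_R0.
    + rewrite H. f_equal. f_equal.
      rewrite ?mult_INR, ?plus_INR, ?mult_INR, !S_INR. change (INR 0) with 0. ring.
Qed.

(** The ratio test step shared by the series of cos and sin at a point y <= 4. *)
Lemma Rabs_mul_pow_succ_le (u : nat -> R) (y d : R) (n : nat) (p : R) :
  0 <= y <= 4 -> 0 < p ->
  Rabs (u (S n)) = Rabs (u n) / d -> 4 <= p * d ->
  Rabs (u (S n) * y ^ S n) <= p * Rabs (u n * y ^ n).
Proof.
  intros Hy Hp Hu Hd.
  assert (Hd0 : 0 < d) by nra.
  rewrite !Rabs_mult, Hu, !(Rabs_pos_eq (y ^ _)) by (apply pow_le; lra).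
  simpl.
  replace (Rabs (u n) / d * (y * y ^ n)) with (y / d * (Rabs (u n) * y ^ n)) by (field; lra).
  apply Rmult_le_compat_r.
  - apply Rmult_le_pos; [apply Rabs_pos | apply pow_le; lra].
  - apply (Rmult_le_reg_r d); [exact Hd0|].
    replace (y / d * d) with y by (field; lra). lra.
Qed.

(** From the term of index 2 on, consecutive terms have ratio at most
    4 / (5 * 6) = 2 / 15, and y^2 / 4! <= 2 / 3. *)
Lemma cos_term_bound (y : R) (n : nat) :
  0 <= y <= 4 -> Rabs (cos_n (S (S n)) * y ^ S (S n)) <= 2 / 3 * (2 / 15) ^ n.
Proof.
  intros Hy. induction n as [|n IH].
  - unfold cos_n. simpl.
    replace (_ / _ * _) with (y * y / 24) by field.
    rewrite Rabs_pos_eq; nra.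
  - eapply Rle_trans.
    + apply (Rabs_mul_pow_succ_le cos_n y _ _ (2 / 15) Hy ltac:(lra) (Rabs_cos_n_succ _)).
      rewrite !S_INR. generalize (pos_INR n). nra.
    + simpl pow in *. lra.
Qed.

(** The ratios are at most 4 / (2 * 3), which is below 19 / 20. *)
Lemma sin_term_bound (y : R) (n : nat) :
  0 <= y <= 4 -> Rabs (sin_n n * y ^ n) <= (19 / 20) ^ n.
Proof.
  intros Hy. induction n as [|n IH].
  - unfold sin_n. simpl. rewrite Rabs_pos_eq; lra.
  - eapply Rle_trans.
    + apply (Rabs_mul_pow_succ_le sin_n y _ _ (19 / 20) Hy ltac:(lra) (Rabs_sin_n_succ _)).
      generalize (pos_INR n). nra.
    + simpl pow in *. lra.
Qed.

Lemma series_tail_bound (c : nat -> R) (l K q : R) (n : nat) :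
  0 <= q < 1 ->
  is_series c l ->
  (forall m, Rabs (c (S (n + m))) <= K * q ^ m) ->
  Rabs (l - sum_f_R0 c n) <= K / (1 - q).
Proof.
  intros Hq Hc Hb.
  assert (Hfin : forall m, Rabs (sum_f_R0 c (n + m)%nat - sum_f_R0 c n)
                           <= K / (1 - q) * (1 - q ^ m)).
  { induction m as [|m IH].
    - rewrite Nat.add_0_r, !Rminus_diag, Rabs_R0. simpl. lra.
    - rewrite Nat.add_succ_r, tech5.
      replace (sum_f_R0 c (n + m) + c (S (n + m)) - sum_f_R0 c n)
        with (sum_f_R0 c (n + m) - sum_f_R0 c n + c (S (n + m))) by ring.
      eapply Rle_trans; [apply Rabs_triang|].
      replace (K / (1 - q) * (1 - q ^ S m))
        with (K / (1 - q) * (1 - q ^ m) + K * q ^ m) by (simpl; field; lra).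
      apply Rplus_le_compat; [exact IH | apply Hb]. }
  assert (HK : 0 <= K).
  { generalize (Rle_trans _ _ _ (Rabs_pos _) (Hb 0%nat)). simpl. lra. }
  assert (Hle : forall m, Rabs (sum_f_R0 c (n + m)%nat - sum_f_R0 c n) <= K / (1 - q)).
  { intros m. eapply Rle_trans; [apply Hfin|].
    assert (Hp := pow_le q m ltac:(lra)).
    rewrite <- (Rmult_1_r (K / (1 - q))) at 2.
    apply Rmult_le_compat_l; [|lra].
    apply Rmult_le_pos; [lra|]. apply Rlt_le, Rinv_0_lt_compat. lra. }
  assert (H : is_lim_seq (fun m => Rabs (sum_f_R0 c (n + m)%nat - sum_f_R0 c n))
                (Rabs (l - sum_f_R0 c n))).
  { apply (is_lim_seq_abs _ (Finite _)).
    apply is_lim_seq_minus'; [|apply is_lim_seq_const].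
    apply (is_lim_seq_ext (fun m => sum_f_R0 c (m + n)%nat)).
    - intros m. now rewrite Nat.add_comm.
    - apply (is_lim_seq_incr_n (sum_f_R0 c)).
      apply is_lim_seq_Reals. now apply is_series_Reals in Hc. }
  exact (is_lim_seq_le _ _ _ _ Hle H (is_lim_seq_const _)).
Qed.

Lemma ex_series_Rabs_geom (u : nat -> R) (K q : R) :
  0 <= q < 1 -> (forall n, Rabs (u n) <= K * q ^ n) ->
  ex_series (fun n => Rabs (u n)).
Proof.
  intros Hq Hu.
  apply (@ex_series_le R_AbsRing R_CompleteNormedModule _ (fun n => K * q ^ n)).
  - intros n. change (norm (Rabs (u n))) with (Rabs (Rabs (u n))).
    rewrite Rabs_Rabsolu. apply Hu.
  - exists (K * / (1 - q)). apply (is_series_scal_l K (fun n => q ^ n) (/ (1 - q))).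
    apply is_series_geom. rewrite Rabs_pos_eq; lra.
Qed.

(** The expansion of tan x / x has a simple pole at x^2 = (pi/2)^2 and no other
    singularity in a slightly larger disc.  The rate q = 19 / 20 is close
    enough to 1 for (10 / 13) / (q - 2 / 15) <= 19 / 20. *)
Theorem tan_coef_asymptotics (T : nat -> R) :
  is_tangent_numbers T ->
  exists l M, 0 < l /\
    forall n, Rabs (tan_coef T n * Rsqr (PI / 2) ^ n - l) <= M * (19 / 20) ^ n.
Proof.
  intros HT.
  set (y := Rsqr (PI / 2)).
  assert (Hy : 0 < y <= 4) by exact Rsqr_PI2_bounds.
  set (c := fun k => cos_n k * y ^ k).
  set (a := fun k => tan_coef T k * y ^ k).
  set (b := fun k => sin_n k * y ^ k).
  assert (Hc : is_series c 0).
  { rewrite <- cos_PI2. apply is_pseries_R, is_pseries_cos_n. }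
  assert (Hb : is_series b (2 / PI)).
  { replace (2 / PI) with (sin (PI / 2) / (PI / 2))
      by (rewrite sin_PI2; field; apply PI_neq0).
    apply is_pseries_R, is_pseries_sin_n. generalize PI2_3_2; lra. }
  set (r := sum_f_R0 c). set (D := backward a).
  assert (Hconv : forall n, PS_mult r D n = b n).
  { intros n. unfold r, D, b. rewrite PS_mult_sum_backward.
    rewrite <- (tan_coef_convolution T HT). unfold PS_mult.
    rewrite Rmult_comm, scal_sum. apply sum_eq. intros i Hi. unfold c, a.
    replace (y ^ n) with (y ^ i * y ^ (n - i)) by (rewrite <- pow_add; f_equal; lia).
    ring. }
  (* As c sums to cos (pi/2) = 0, its partial sums are minus its tails. *)
  assert (Hr : forall k, Rabs (r (S k)) <= 10 / 13 * (2 / 15) ^ k).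
  { intros k. replace (r (S k)) with (- (0 - sum_f_R0 c (S k))) by (unfold r; ring).
    rewrite Rabs_Ropp.
    replace (10 / 13 * (2 / 15) ^ k) with (2 / 3 * (2 / 15) ^ k / (1 - 2 / 15)) by field.
    apply series_tail_bound; [lra | exact Hc |].
    intros m. rewrite Rmult_assoc, <- pow_add. apply cos_term_bound. lra. }
  assert (Hr0 : r 0%nat = 1) by (unfold r, c, cos_n; simpl; field).
  assert (HD : forall n, Rabs (D n) <= 20 * (19 / 20) ^ n).
  { apply (decay_of_convolution r D b (10 / 13) (2 / 15)); try lra; try assumption.
    intros n. apply sin_term_bound. lra. }
  assert (HDs := ex_series_Rabs_geom D 20 (19 / 20) ltac:(lra) HD).
  assert (Hrs : ex_series (fun n => Rabs (r n))).
  { apply ex_series_incr_1. exact (ex_series_Rabs_geom _ (10 / 13) (2 / 15) ltac:(lra) Hr). }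
  destruct (ex_series_Rabs _ HDs) as [l Hl].
  destruct (ex_series_Rabs _ Hrs) as [lr Hlr].
  exists l, 380. split.
  - assert (Hlr0 : 0 < lr).
    { assert (H := series_tail_bound r lr (10 / 13) (2 / 15) 0 ltac:(lra) Hlr Hr).
      simpl sum_f_R0 in H. rewrite Hr0 in H. apply Rabs_le_between in H.
      replace (10 / 13 / (1 - 2 / 15)) with (150 / 169) in H by field. lra. }
    (* At u = 1 the product of the two series gives lr * l = sin (pi/2) / (pi/2). *)
    assert (H := is_series_mult _ _ _ _ Hlr Hl Hrs HDs).
    apply (is_series_ext _ b) in H; [|exact Hconv].
    apply is_series_unique in H. rewrite (is_series_unique _ _ Hb) in H.
    assert (0 < 2 / PI) by (apply Rdiv_lt_0_compat; [lra | apply PI_RGT_0]).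
    rewrite H in *. apply (Rmult_lt_reg_l lr); lra.
  - intros n. rewrite Rabs_minus_sym. change (tan_coef T n * y ^ n) with (a n).
    rewrite <- (sum_backward a n).
    replace (380 * (19 / 20) ^ n) with (19 * (19 / 20) ^ n / (1 - 19 / 20)) by field.
    apply series_tail_bound; [lra | exact Hl |].
    intros m. eapply Rle_trans; [apply HD|].
    rewrite <- Nat.add_succ_l, pow_add. simpl. lra.
Qed.

(** * Iterated forward differences *)

Definition fdiff (u : nat -> R) : nat -> R := fun n => u (S n) - u n.

Lemma iter_fdiff_succ (k : nat) (u : nat -> R) (n : nat) :
  Nat.iter (S k) fdiff u n = Nat.iter k fdiff u (S n) - Nat.iter k fdiff u n.
Proof. reflexivity. Qed.

Lemma iter_fdiff_succ_r (k : nat) (u : nat -> R) :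
  Nat.iter (S k) fdiff u = Nat.iter k fdiff (fdiff u).
Proof. apply Nat.iter_succ_r. Qed.

Lemma iter_fdiff_ext (N k : nat) (u v : nat -> R) :
  (forall n, (N <= n)%nat -> u n = v n) ->
  forall n, (N <= n)%nat -> Nat.iter k fdiff u n = Nat.iter k fdiff v n.
Proof.
  intros H. induction k as [|k IH]; intros n Hn; [now apply H|].
  rewrite !iter_fdiff_succ, !IH by lia. reflexivity.
Qed.

Lemma iter_fdiff_plus (k : nat) (u v : nat -> R) (n : nat) :
  Nat.iter k fdiff (fun n => u n + v n) n = Nat.iter k fdiff u n + Nat.iter k fdiff v n.
Proof.
  revert n; induction k as [|k IH]; intros n; [reflexivity|].
  rewrite !iter_fdiff_succ, !IH. ring.
Qed.

Lemma iter_fdiff_shift (k : nat) (u : nat -> R) (n : nat) :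
  Nat.iter k fdiff (fun n => u (S n)) n = Nat.iter k fdiff u (S n).
Proof.
  revert n; induction k as [|k IH]; intros n; [reflexivity|].
  now rewrite !iter_fdiff_succ, !IH.
Qed.

Lemma iter_fdiff_INR_mult (k : nat) (f : nat -> R) (n : nat) :
  Nat.iter (S k) fdiff (fun n => INR n * f n) n =
  INR n * Nat.iter (S k) fdiff f n + INR (S k) * Nat.iter k fdiff f (S n).
Proof.
  revert n; induction k as [|k IH]; intros n.
  - change (INR (S n) * f (S n) - INR n * f n = INR n * (f (S n) - f n) + 1 * f (S n)).
    rewrite S_INR. ring.
  - rewrite iter_fdiff_succ, !IH, !(iter_fdiff_succ (S k)), !(iter_fdiff_succ k), !S_INR. ring.
Qed.

Lemma iter_fdiff_geom_bound (N k : nat) (u : nat -> R) (M q : R) :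
  0 <= q <= 1 ->
  (forall n, (N <= n)%nat -> Rabs (u n) <= M * q ^ n) ->
  forall n, (N <= n)%nat -> Rabs (Nat.iter k fdiff u n) <= 2 ^ k * M * q ^ n.
Proof.
  intros Hq Hu. induction k as [|k IH]; intros n Hn.
  - simpl (2 ^ 0). rewrite Rmult_1_l. now apply Hu.
  - rewrite iter_fdiff_succ. unfold Rminus.
    eapply Rle_trans; [apply Rabs_triang|]. rewrite Rabs_Ropp.
    assert (H1 := IH n Hn). assert (H2 := IH (S n) ltac:(lia)).
    assert (H0 := Rle_trans _ _ _ (Rabs_pos _) H1).
    simpl pow in *. nra.
Qed.

(** A k-th difference is a k-th derivative at an intermediate point.  The
    induction takes the outermost difference into the function, so it must range
    over whole families d of successive derivatives: t |-> d j (t + 1) - d j t is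
    again such a family, and one mean value theorem turns its k-th member into
    the (k+1)-st of d. *)
Lemma iter_fdiff_mean_value (k : nat) :
  forall (d : nat -> R -> R) (x : R) (n : nat),
  0 < x ->
  (forall j t, 0 < t -> is_derive (d j) t (d (S j) t)) ->
  exists xi, x + INR n <= xi <= x + INR n + INR k /\
    Nat.iter k fdiff (fun m => d 0%nat (x + INR m)) n = d k xi.
Proof.
  induction k as [|k IH]; intros d x n Hx Hd.
  - exists (x + INR n). split; [simpl; lra | reflexivity].
  - assert (Hn := pos_INR n).
    destruct (IH (fun j t => d j (t + 1) - d j t) x n Hx) as (xi & Hxi & E).
    { intros j t Ht. apply (is_derive_minus (fun t => d j (t + 1)) (d j) t (d (S j) (t + 1)) (d (S j) t));
        [|now apply Hd].
      rewrite <- (Rmult_1_l (d (S j) (t + 1))).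
      apply (is_derive_comp (d j) (fun t => t + 1)); [apply Hd; lra|].
      auto_derive; [exact I | reflexivity]. }
    destruct (MVT_cor2 (d k) (d (S k)) xi (xi + 1)) as (eta & He & Heta); [lra| |].
    { intros t Ht. apply is_derive_Reals, Hd. lra. }
    exists eta. split; [rewrite S_INR; lra|].
    rewrite iter_fdiff_succ_r.
    rewrite (iter_fdiff_ext 0 k _ (fun m => d 0%nat (x + INR m + 1) - d 0%nat (x + INR m))); [| |lia].
    + rewrite E, He. ring.
    + intros m _. unfold fdiff. rewrite S_INR, Rplus_assoc. reflexivity.
Qed.

(** * Sequences whose differences behave like those of the logarithm *)

(** The constants are those of c ln: x^(k+1) times its (k+1)-st derivative
    is c (-1)^k k!.  Only differences of order at least 1 are constrained, so
    that the notion is blind to additive constants. *)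
Definition log_like (c : R) (u : nat -> R) : Prop :=
  forall k, is_lim_seq (fun n => INR n ^ S k * Nat.iter (S k) fdiff u n)
              (c * ((-1) ^ k * INR (fact k))).

Lemma is_lim_seq_pow (u : nat -> R) (l : R) (k : nat) :
  is_lim_seq u l -> is_lim_seq (fun n => u n ^ k) (l ^ k).
Proof.
  intros Hu. induction k as [|k IH]; [apply is_lim_seq_const|].
  now apply is_lim_seq_mult'.
Qed.

Lemma is_lim_seq_INR_div (a : R) :
  0 < a -> is_lim_seq (fun n => INR n / (INR n + a)) 1.
Proof.
  intros Ha.
  apply (is_lim_seq_ext (fun n => 1 - a * / (INR n + a))).
  { intros n. generalize (pos_INR n); intros. field. lra. }
  replace (Finite 1) with (Finite (1 - a * 0)) by (f_equal; ring).
  apply is_lim_seq_minus'; [apply is_lim_seq_const|].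
  apply is_lim_seq_mult'; [apply is_lim_seq_const|].
  apply (is_lim_seq_inv _ p_infty); [|discriminate].
  apply (is_lim_seq_plus _ _ p_infty a p_infty); [apply is_lim_seq_INR | apply is_lim_seq_const | reflexivity].
Qed.

Lemma is_lim_seq_pow_INR_shift (u : nat -> R) (k : nat) (l : R) :
  is_lim_seq (fun n => INR n ^ k * u n) l <->
  is_lim_seq (fun n => INR n ^ k * u (S n)) l.
Proof.
  rewrite is_lim_seq_incr_1.
  assert (H1 := is_lim_seq_pow _ _ k (is_lim_seq_INR_div 1 Rlt_0_1)).
  rewrite pow1 in H1.
  split; intros H.
  - apply (is_lim_seq_ext (fun n => (INR n / (INR n + 1)) ^ k * (INR (S n) ^ k * u (S n)))).
    + intros n. rewrite S_INR, <- Rmult_assoc, <- Rpow_mult_distr.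
      do 2 f_equal. generalize (pos_INR n); intros. field. lra.
    + replace l with (1 * l) by ring. now apply is_lim_seq_mult'.
  - apply (is_lim_seq_ext_loc (fun n => / (INR n / (INR n + 1)) ^ k * (INR n ^ k * u (S n)))).
    + exists 1%nat. intros n Hn. apply (le_INR 1) in Hn. simpl in Hn.
      rewrite S_INR, <- Rmult_assoc, <- pow_inv, <- Rpow_mult_distr.
      do 2 f_equal. field. lra.
    + replace l with (1 * l) by ring. apply is_lim_seq_mult'; [|exact H].
      replace (Finite 1) with (Rbar_inv 1) by (simpl; f_equal; apply Rinv_1).
      apply (is_lim_seq_inv _ 1 H1). intros E; injection E; lra.
Qed.

Lemma log_like_ext (N : nat) (c : R) (u v : nat -> R) :
  (forall n, (N <= n)%nat -> u n = v n) -> log_like c u -> log_like c v.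
Proof.
  intros H Hu k. refine (is_lim_seq_ext_loc _ _ _ _ (Hu k)).
  exists N. intros n Hn. now rewrite (iter_fdiff_ext N (S k) u v H n Hn).
Qed.

Lemma log_like_plus (c d : R) (u v : nat -> R) :
  log_like c u -> log_like d v -> log_like (c + d) (fun n => u n + v n).
Proof.
  intros Hu Hv k.
  apply (is_lim_seq_ext (fun n => INR n ^ S k * Nat.iter (S k) fdiff u n
                                + INR n ^ S k * Nat.iter (S k) fdiff v n)).
  - intros n. rewrite iter_fdiff_plus. ring.
  - rewrite Rmult_plus_distr_r. apply is_lim_seq_plus'; [apply Hu | apply Hv].
Qed.

Lemma log_like_shift (c : R) (u : nat -> R) :
  log_like c (fun n => u (S n)) -> log_like c u.
Proof.
  intros H k. apply is_lim_seq_pow_INR_shift.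
  apply (is_lim_seq_ext _ _ _ (fun n => f_equal _ (iter_fdiff_shift (S k) u n)) (H k)).
Qed.

Lemma log_like_const (C : R) : log_like 0 (fun _ => C).
Proof.
  intros k. rewrite Rmult_0_l.
  apply (is_lim_seq_ext (fun _ => 0)); [|apply is_lim_seq_const].
  intros n. replace (Nat.iter (S k) fdiff (fun _ => C) n) with 0; [ring|].
  revert n; induction k as [|k IH]; intros n.
  - rewrite iter_fdiff_succ. simpl. ring.
  - rewrite iter_fdiff_succ, <- !IH. ring.
Qed.

Lemma is_lim_seq_pow_mult_geom (q : R) (k : nat) :
  0 < q < 1 -> is_lim_seq (fun n => INR n ^ k * q ^ n) 0.
Proof.
  intros Hq. apply is_lim_seq_incr_1, is_lim_seq_abs_0, ex_series_lim_0.
  assert (Hpos : forall n, 0 < INR (S n) ^ k * q ^ S n).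
  { intros n. apply Rmult_lt_0_compat; apply pow_lt; [apply lt_0_INR; lia | lra]. }
  apply (ex_series_DAlembert _ q); [lra | intros n; generalize (Hpos n); lra |].
  apply (is_lim_seq_ext (fun n => / (INR (S n) / (INR (S n) + 1)) ^ k * q)).
  - intros n.
    assert (Hn : 0 < INR (S n)) by (apply lt_0_INR; lia).
    rewrite Rabs_pos_eq.
    + rewrite (S_INR (S n)), <- pow_inv.
      replace (/ (INR (S n) / (INR (S n) + 1))) with ((INR (S n) + 1) * / INR (S n)) by (field; lra).
      rewrite Rpow_mult_distr, pow_inv. simpl (q ^ _). field.
      repeat split; try lra; apply pow_nonzero; lra.
    + apply Rlt_le, Rdiv_lt_0_compat; apply Hpos.
  - replace (Finite q) with (Finite (1 * q)) by (f_equal; ring). apply is_lim_seq_mult'; [|apply is_lim_seq_const].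
    replace (Finite 1) with (Rbar_inv (1 ^ k)) by (simpl; f_equal; rewrite pow1; apply Rinv_1).
    apply is_lim_seq_inv; [|intros E; injection E; rewrite pow1; lra].
    apply is_lim_seq_pow. apply (is_lim_seq_incr_1 (fun n => INR n / (INR n + 1))).
    apply is_lim_seq_INR_div. lra.
Qed.

Lemma log_like_geom (N : nat) (u : nat -> R) (M q : R) :
  0 < q < 1 -> (forall n, (N <= n)%nat -> Rabs (u n) <= M * q ^ n) ->
  log_like 0 u.
Proof.
  intros Hq Hu k. rewrite Rmult_0_l. apply is_lim_seq_abs_0.
  apply (is_lim_seq_le_le_loc (fun _ => 0) _
           (fun n => 2 ^ S k * M * (INR n ^ S k * q ^ n))).
  - exists N. intros n Hn. split; [apply Rabs_pos|].
    rewrite Rabs_mult, Rabs_pos_eq by apply pow_le, pos_INR.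
    assert (H := iter_fdiff_geom_bound N (S k) u M q ltac:(lra) Hu n Hn).
    apply (Rmult_le_compat_l _ _ _ (pow_le (INR n) (S k) (pos_INR n))) in H. lra.
  - apply is_lim_seq_const.
  - replace (Finite 0) with (Rbar_mult (2 ^ S k * M) 0) by (simpl; f_equal; ring).
    apply is_lim_seq_scal_l. now apply is_lim_seq_pow_mult_geom.
Qed.

(** The successive derivatives of ln, the function itself being the 0-th. *)
Definition ln_deriv (j : nat) (x : R) : R :=
  match j with
  | O => ln x
  | S k => (-1) ^ k * INR (fact k) * / x ^ S k
  end.

Lemma is_derive_ln_deriv (j : nat) (x : R) :
  0 < x -> is_derive (ln_deriv j) x (ln_deriv (S j) x).
Proof.
  intros Hx. destruct j as [|k]; unfold ln_deriv.
  - replace (_ * _ * _) with (/ x) by (simpl; field; lra). now apply is_derive_ln.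
  - assert (Hp : x ^ k <> 0) by (apply pow_nonzero; lra).
    auto_derive.
    + apply (pow_nonzero x (S k)). lra.
    + rewrite fact_simpl, mult_INR. change (match k with O => 1 | S _ => INR k + 1 end) with (INR (S k)).
      simpl pow. field. lra.
Qed.

Lemma log_like_ln (a : R) : 0 < a -> log_like 1 (fun n => ln (a + INR n)).
Proof.
  intros Ha k. rewrite Rmult_1_l.
  set (C := (-1) ^ k * INR (fact k)).
  (* Normalized by C, the difference is (n / xi)^(k+1) with xi between n + a and
     n + a + k + 1, which leaves a squeeze.  As C^-1 = (-1)^k / k!, the signs
     cancel in pairs. *)
  apply (is_lim_seq_ext (fun n =>
    C * (INR n ^ S k * ((-1) ^ k * / INR (fact k) * Nat.iter (S k) fdiff (fun n => ln (a + INR n)) n)))).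
  { intros n. unfold C.
    replace (Nat.iter (S k) fdiff (fun n => ln (a + INR n)) n)
      with ((-1) ^ k * (-1) ^ k * Nat.iter (S k) fdiff (fun n => ln (a + INR n)) n) at 2.
    - field. apply INR_fact_neq_0.
    - rewrite <- Rpow_mult_distr. replace (-1 * -1) with 1 by ring. rewrite pow1. ring. }
  replace (Finite C) with (Rbar_mult C 1) by (simpl; f_equal; ring).
  apply is_lim_seq_scal_l.
  apply (is_lim_seq_le_le
    (fun n => (INR n / (INR n + (a + INR (S k)))) ^ S k) _
    (fun n => (INR n / (INR n + a)) ^ S k)).
  - intros n.
    destruct (iter_fdiff_mean_value (S k) ln_deriv a n Ha is_derive_ln_deriv) as (xi & Hxi & E).
    unfold ln_deriv in E at 1. rewrite E. unfold ln_deriv.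
    assert (Hn := pos_INR n). assert (Hk := pos_INR (S k)).
    replace (INR n ^ S k * ((-1) ^ k * / INR (fact k) * ((-1) ^ k * INR (fact k) * / xi ^ S k)))
      with ((INR n / xi) ^ S k).
    + assert (H : INR n / (INR n + (a + INR (S k))) <= INR n / xi <= INR n / (INR n + a)).
      { split; apply Rmult_le_compat_l; try lra; apply Rinv_le_contravar; lra. }
      assert (H0 : 0 <= INR n / (INR n + (a + INR (S k)))).
      { apply Rmult_le_pos; [lra|]. apply Rlt_le, Rinv_0_lt_compat. lra. }
      split; apply pow_incr; lra.
    + unfold Rdiv. rewrite Rpow_mult_distr, pow_inv.
      transitivity (INR n ^ S k * ((-1) ^ k * (-1) ^ k) * / xi ^ S k).
      * rewrite <- (Rpow_mult_distr (-1)). replace (-1 * -1) with 1 by ring. rewrite pow1. ring.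
      * field. split; [apply (pow_nonzero xi (S k)); lra | apply INR_fact_neq_0].
  - rewrite <- (pow1 (S k)). apply is_lim_seq_pow, is_lim_seq_INR_div.
    generalize (pos_INR (S k)); lra.
  - rewrite <- (pow1 (S k)). now apply is_lim_seq_pow, is_lim_seq_INR_div.
Qed.

(** Cesaro means of the differences, which telescope. *)
Lemma is_lim_seq_div_INR_of_fdiff (v : nat -> R) (l : R) :
  is_lim_seq (fdiff v) l -> is_lim_seq (fun n => v n / INR n) l.
Proof.
  intros H. apply is_lim_seq_Reals, Cesaro_1, is_lim_seq_Reals in H.
  apply (is_lim_seq_ext_loc (fun n => sum_f_R0 (fdiff v) (pred n) / INR n + v 0%nat * / INR n)).
  - exists 1%nat. intros n Hn. destruct n as [|n]; [lia|]. simpl pred.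
    replace (sum_f_R0 (fdiff v) n) with (v (S n) - v 0%nat).
    + field. apply not_0_INR. lia.
    + clear. induction n as [|n IH]; [reflexivity|]. rewrite tech5, <- IH. unfold fdiff. ring.
  - replace l with (l + v 0%nat * 0) by ring.
    apply is_lim_seq_plus'; [exact H|]. apply is_lim_seq_mult'; [apply is_lim_seq_const|].
    exact (is_lim_seq_inv _ _ is_lim_seq_INR ltac:(discriminate)).
Qed.

(** Write G n = n * f n.  For order at least 2 the product rule expresses
    n^(k+2) Delta^(k+2) f through Delta^(k+2) G and the limit already known one
    order below, and the constants satisfy
    (-1)^k k! - (k+2) (-1)^k k! = (-1)^(k+1) (k+1)!.
    For order 1 the same rule at order 2 says that n (n+1) Delta f n has
    differences (n+1) Delta^2 G n, which tend to c; hence n (n+1) Delta f n is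
    asymptotic to c n. *)
Lemma log_like_of_fdiff_INR_mult (c : R) (f : nat -> R) :
  log_like c (fdiff (fun n => INR n * f n)) -> log_like c f.
Proof.
  intros HG.
  assert (E : forall k n, Nat.iter (S k) fdiff (fdiff (fun n => INR n * f n)) n =
    INR n * Nat.iter (S (S k)) fdiff f n + INR (S (S k)) * Nat.iter (S k) fdiff f (S n)).
  { intros k n. rewrite <- iter_fdiff_succ_r. apply iter_fdiff_INR_mult. }
  intros k. induction k as [|k IH].
  - assert (Hv : is_lim_seq (fdiff (fun n => INR n * (INR n + 1) * fdiff f n)) c).
    { assert (H0 := HG 0%nat). simpl (fact 0) in H0. simpl ((-1) ^ 0) in H0.
      rewrite Rmult_1_l, Rmult_1_r in H0.
      assert (H1 := is_lim_seq_INR_div 1 Rlt_0_1).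
      apply (is_lim_seq_ext_loc (fun n => / (INR n / (INR n + 1)) *
         (INR n ^ 1 * Nat.iter 1 fdiff (fdiff (fun n => INR n * f n)) n))).
      - exists 1%nat. intros n Hn. apply (le_INR 1) in Hn. simpl in Hn.
        rewrite E. simpl Nat.iter. unfold fdiff. rewrite !S_INR. simpl (INR 0). field. lra.
      - replace c with (1 * c) by ring. apply is_lim_seq_mult'; [|exact H0].
        replace (Finite 1) with (Rbar_inv 1) by (simpl; f_equal; apply Rinv_1).
        apply is_lim_seq_inv; [exact H1 | intros e; injection e; lra]. }
    apply is_lim_seq_div_INR_of_fdiff in Hv.
    simpl (fact 0). simpl ((-1) ^ 0). rewrite Rmult_1_l.
    apply (is_lim_seq_ext_loc (fun n => INR n / (INR n + 1) * (INR n * (INR n + 1) * fdiff f n / INR n))).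
    + exists 1%nat. intros n Hn. apply (le_INR 1) in Hn. simpl in Hn.
      simpl Nat.iter. simpl pow. field. lra.
    + replace (c * INR 1) with (1 * c) by (simpl; ring).
      apply is_lim_seq_mult'; [apply is_lim_seq_INR_div; lra | exact Hv].
  - apply (is_lim_seq_ext (fun n =>
      INR n ^ S k * Nat.iter (S k) fdiff (fdiff (fun n => INR n * f n)) n
      - INR (S (S k)) * (INR n ^ S k * Nat.iter (S k) fdiff f (S n)))).
    + intros n. rewrite E. simpl pow. ring.
    + replace (c * ((-1) ^ S k * INR (fact (S k))))
        with (c * ((-1) ^ k * INR (fact k)) - INR (S (S k)) * (c * ((-1) ^ k * INR (fact k)))).
      * apply is_lim_seq_minus'; [apply HG|].
        apply is_lim_seq_mult'; [apply is_lim_seq_const|].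
        now apply (is_lim_seq_pow_INR_shift (Nat.iter (S k) fdiff f)).
      * rewrite fact_simpl, mult_INR, !S_INR. simpl pow. ring.
Qed.

Lemma log_like_sign (c : R) (u : nat -> R) (k : nat) :
  0 < c -> log_like c u ->
  exists N, forall n, (N <= n)%nat -> 0 < (-1) ^ k * Nat.iter (S k) fdiff u n.
Proof.
  intros Hc Hu.
  assert (H : is_lim_seq (fun n => (-1) ^ k * (INR n ^ S k * Nat.iter (S k) fdiff u n)) (c * INR (fact k))).
  { replace (c * INR (fact k)) with ((-1) ^ k * (c * ((-1) ^ k * INR (fact k)))).
    - apply is_lim_seq_mult'; [apply is_lim_seq_const | apply Hu].
    - transitivity ((-1) ^ k * (-1) ^ k * (c * INR (fact k))); [ring|].
      rewrite <- Rpow_mult_distr. replace (-1 * -1) with 1 by ring. rewrite pow1. ring. }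
  assert (Hl : 0 < c * INR (fact k)) by (apply Rmult_lt_0_compat; [exact Hc | apply INR_fact_lt_0]).
  apply is_lim_seq_spec in H. destruct (H (mkposreal _ Hl)) as [N HN].
  exists N. intros n Hn. specialize (HN n Hn). cbn [pos] in HN.
  apply Rabs_lt_between in HN.
  assert (Hp := pow_le (INR n) (S k) (pos_INR n)).
  apply (Rmult_lt_reg_l (INR n ^ S k)); [|lra].
  destruct (Rle_lt_or_eq_dec _ _ Hp) as [|E]; [assumption|].
  rewrite <- E in HN. lra.
Qed.

(** * The tangent numbers *)

(** Both bounds come from ln t <= t - 1, used at x and at 1 / x. *)
Lemma Rabs_ln_le (x : R) : Rabs (x - 1) <= 1 / 2 -> Rabs (ln x) <= 2 * Rabs (x - 1).
Proof.
  intros Hx. apply Rabs_le_between in Hx.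
  assert (H1 := exp_ineq1_le (x - 1)).
  assert (U : ln x <= x - 1).
  { rewrite <- (ln_exp (x - 1)). apply ln_le; lra. }
  assert (L : 1 - / x <= ln x).
  { assert (H2 := exp_ineq1_le (/ x - 1)).
    assert (Hinv : 0 < / x) by (apply Rinv_0_lt_compat; lra).
    assert (H3 : ln (/ x) <= / x - 1).
    { rewrite <- (ln_exp (/ x - 1)). apply ln_le; lra. }
    rewrite ln_Rinv in H3; lra. }
  assert (E : 1 - / x = (x - 1) * / x) by (field; lra).
  assert (Hinv : / x <= 2).
  { replace 2 with (/ (1 / 2)) by field. apply Rinv_le_contravar; lra. }
  assert (Hinv0 : 0 < / x) by (apply Rinv_0_lt_compat; lra).
  rewrite E in L.
  unfold Rabs at 2. destruct (Rcase_abs (x - 1)); apply Rabs_le; split; nra.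
Qed.

Lemma geom_eventually_le (M q e : R) :
  0 <= q < 1 -> 0 < e -> exists N, forall n, (N <= n)%nat -> M * q ^ n <= e.
Proof.
  intros Hq He.
  assert (H : is_lim_seq (fun n => M * q ^ n) (M * 0)).
  { apply is_lim_seq_mult'; [apply is_lim_seq_const|].
    apply is_lim_seq_geom. rewrite Rabs_pos_eq; lra. }
  apply is_lim_seq_spec in H. destruct (H (mkposreal e He)) as [N HN].
  exists N. intros n Hn. specialize (HN n Hn). cbn [pos] in HN.
  apply Rabs_lt_between in HN. lra.
Qed.

(** From T (n + 1) = (2n+1)! a_n / (pi/2)^(2n) and
    (2n+2) (2n+3) = 4 (n+1) (n+3/2).  Dividing a_n by its limit l makes the last
    term small. *)
Lemma ln_tangent_number_diff (T : nat -> R) (l : R) (n : nat) :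
  0 < l ->
  let a := fun n => tan_coef T n * Rsqr (PI / 2) ^ n in
  0 < a n -> 0 < a (S n) ->
  ln (T (S (S n))) - ln (T (S n)) =
  ln (1 + INR n) + ln (3 / 2 + INR n) + (ln 4 - ln (Rsqr (PI / 2)))
  + fdiff (fun n => ln (a n / l)) n.
Proof.
  intros Hl a Ha HSa.
  destruct Rsqr_PI2_bounds as [Hy _].
  set (y := Rsqr (PI / 2)) in *.
  assert (Hn := pos_INR n).
  assert (Hyn : 0 < y ^ n) by now apply pow_lt.
  assert (HF := INR_fact_lt_0 (2 * n + 1)).
  assert (E0 : a n = T (S n) / INR (fact (2 * n + 1)) * y ^ n).
  { unfold a, tan_coef. now replace (2 * S n - 1)%nat with (2 * n + 1)%nat by lia. }
  assert (E1 : a (S n) =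
    T (S (S n)) / (4 * (1 + INR n) * (3 / 2 + INR n) * INR (fact (2 * n + 1))) * (y * y ^ n)).
  { unfold a, tan_coef. replace (2 * S (S n) - 1)%nat with (S (S (2 * n + 1))) by lia.
    rewrite !fact_simpl, !mult_INR.
    replace (INR (S (S (2 * n + 1)))) with (2 * (3 / 2 + INR n))
      by (rewrite !S_INR, plus_INR, mult_INR; simpl; field).
    replace (INR (S (2 * n + 1))) with (2 * (1 + INR n))
      by (rewrite !S_INR, plus_INR, mult_INR; simpl; field).
    change (y ^ S n) with (y * y ^ n). field. lra. }
  assert (T0 : T (S n) = l * (a n / l) * INR (fact (2 * n + 1)) * / y ^ n).
  { rewrite E0. field. lra. }
  assert (T1 : T (S (S n)) = l * (a (S n) / l) *
    (4 * (1 + INR n) * (3 / 2 + INR n) * INR (fact (2 * n + 1))) * / (y * y ^ n)).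
  { rewrite E1. field. lra. }
  assert (0 < a n / l) by now apply Rdiv_lt_0_compat.
  assert (0 < a (S n) / l) by now apply Rdiv_lt_0_compat.
  assert (Hyi : 0 < / y ^ n) by now apply Rinv_0_lt_compat.
  assert (0 < / (y * y ^ n)) by (apply Rinv_0_lt_compat; nra).
  unfold fdiff. rewrite T0, T1.
  set (p := a n / l) in *. set (p' := a (S n) / l) in *. clearbody p p'.
  rewrite !ln_mult, !ln_Rinv by (repeat first [lra | apply Rmult_lt_0_compat]).
  rewrite !ln_mult by (repeat first [lra | apply Rmult_lt_0_compat]).
  ring.
Qed.

(** The two logarithms of [ln_tangent_number_diff] contribute 1 each, and its
    two other terms nothing. *)
Theorem log_like_ln_tangent_div (T : nat -> R) :
  is_tangent_numbers T -> log_like 2 (fun n => / INR n * ln (T n)).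
Proof.
  intros HT.
  destruct (tan_coef_asymptotics T HT) as (l & M & Hl & HM).
  set (a := fun n => tan_coef T n * Rsqr (PI / 2) ^ n) in *.
  destruct (geom_eventually_le (M / l) (19 / 20) (1 / 2) ltac:(lra) ltac:(lra)) as [N HN].
  assert (Hrel : forall n, Rabs (a n / l - 1) <= M / l * (19 / 20) ^ n).
  { intros n. replace (a n / l - 1) with ((a n - l) * / l) by (field; lra).
    rewrite Rabs_mult, (Rabs_pos_eq (/ l)) by (apply Rlt_le, Rinv_0_lt_compat; lra).
    replace (M / l * (19 / 20) ^ n) with (M * (19 / 20) ^ n * / l) by (field; lra).
    apply Rmult_le_compat_r; [apply Rlt_le, Rinv_0_lt_compat; lra | apply HM]. }
  assert (Hpos : forall n, (N <= n)%nat -> 0 < a n).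
  { intros n Hn. assert (H := Rle_trans _ _ _ (Hrel n) (HN n Hn)).
    apply Rabs_le_between in H.
    replace (a n) with (a n / l * l) by (field; lra). nra. }
  set (eps := fun n => ln (a n / l)).
  assert (Heps : forall n, (N <= n)%nat -> Rabs (eps n) <= 2 * (M / l) * (19 / 20) ^ n).
  { intros n Hn. eapply Rle_trans.
    - apply Rabs_ln_le. exact (Rle_trans _ _ _ (Hrel n) (HN n Hn)).
    - generalize (Hrel n). lra. }
  assert (Hdeps := iter_fdiff_geom_bound N 1 eps _ (19 / 20) ltac:(lra) Heps).
  apply log_like_of_fdiff_INR_mult, log_like_shift.
  apply (log_like_ext N _ (fun n => ln (1 + INR n) + ln (3 / 2 + INR n)
           + (ln 4 - ln (Rsqr (PI / 2))) + fdiff eps n)).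
  - intros n Hn. unfold eps, a. rewrite <- ln_tangent_number_diff; try (exact Hl).
    + unfold fdiff. field_simplify_eq; [reflexivity|]. split; apply not_0_INR; lia.
    + now apply Hpos.
    + apply Hpos. lia.
  - replace 2 with (1 + 1 + 0 + 0) by ring.
    repeat apply log_like_plus.
    + apply log_like_ln; lra.
    + apply log_like_ln; lra.
    + apply log_like_const.
    + exact (log_like_geom N _ _ (19 / 20) ltac:(lra) Hdeps).
Qed.

(** * From differences to log-monotonicity *)

Lemma iter_ratio_seq_exp (r : nat) (f z : nat -> R) :
  (forall n, z n = exp (- f n)) ->
  forall n, Nat.iter r ratio_seq z n = exp (- Nat.iter r fdiff f n).
Proof.
  intros Hz. induction r as [|r IH]; intros n; [apply Hz|].
  change (Nat.iter (S r) ratio_seq z n)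
    with (Nat.iter r ratio_seq z (n + 1)%nat / Nat.iter r ratio_seq z n).
  rewrite !IH, Nat.add_1_r, iter_fdiff_succ.
  unfold Rdiv. rewrite <- exp_Ropp, <- exp_plus. f_equal. ring.
Qed.

Lemma exp_second_difference_le (x y z : R) :
  x + z <= 2 * y -> exp (- y) ^ 2 <= exp (- x) * exp (- z).
Proof.
  intros H. simpl. rewrite Rmult_1_r, <- !exp_plus.
  destruct (Req_dec (x + z) (2 * y)) as [E|E].
  - right. f_equal. lra.
  - left. apply exp_increasing. lra.
Qed.

Lemma exp_second_difference_ge (x y z : R) :
  2 * y <= x + z -> exp (- y) ^ 2 >= exp (- x) * exp (- z).
Proof.
  intros H. apply Rle_ge. simpl. rewrite Rmult_1_r, <- !exp_plus.
  destruct (Req_dec (x + z) (2 * y)) as [E|E].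
  - right. f_equal. lra.
  - left. apply exp_increasing. lra.
Qed.

(** The second difference of Delta^r f has the sign of (-1)^(r+1) eventually, and
    z is the exponential of - f: even orders are log-convex, odd ones
    log-concave. *)
Theorem almost_infinitely_log_monotonic_of_log_like (c : R) (f z : nat -> R) :
  0 < c -> log_like c f -> (forall n, z n = exp (- f n)) ->
  almost_infinitely_log_monotonic z.
Proof.
  intros Hc Hf Hz. split.
  - intros n _. rewrite Hz. apply exp_pos.
  - intros r. destruct (log_like_sign c f (S r) Hc Hf) as [N HN].
    exists (S N). split; [lia|].
    split; intros Hr n Hn; specialize (HN n ltac:(lia));
      rewrite !(iter_ratio_seq_exp r f z Hz), Nat.add_1_r, (Nat.add_comm n 2);
      rewrite !iter_fdiff_succ in HN.
    + destruct Hr as [m ->]. apply exp_second_difference_le.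
      replace ((-1) ^ S (2 * m)) with (-1) in HN by (rewrite pow_1_odd; reflexivity).
      simpl Nat.add in *. lra.
    + destruct Hr as [m ->]. apply exp_second_difference_ge.
      replace ((-1) ^ S (2 * m + 1)) with 1 in HN
        by (replace (S (2 * m + 1)) with (2 * (m + 1))%nat by lia; rewrite pow_1_even; reflexivity).
      simpl Nat.add in *. lra.
Qed.

Theorem theorem3p12 (T : nat -> R) (hT : is_tangent_numbers T) :
  almost_infinitely_log_monotonic (fun n : nat => 1 / nth_root n (T n)).
Proof.
  apply (almost_infinitely_log_monotonic_of_log_like 2 (fun n => / INR n * ln (T n))).
  - lra.
  - now apply log_like_ln_tangent_div.
  - intros n. unfold nth_root, Rpower. rewrite exp_Ropp. unfold Rdiv. apply Rmult_1_l.
Qed.
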